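(* Let $k\ge 1$ be an integer. Then for all sufficiently large $n$ (that is, there is $n_0=n_0(k)$ such that for all $n\ge n_0$), the graph $\mathrm{KG}(\mathrm{Perm}_n)$ contains a $k$th power of a Hamiltonian cycle.
   Context: The permutohedron is $\mathrm{Perm}_n=\mathrm{conv}\{(\sigma(1),\dots,\sigma(n)) : \sigma\in S_n\}\subset\mathbb{R}^n$; its vertex set is identified with the symmetric group $S_n$. For a polytope $\mathcal{Q}$, the Kneser graph $\mathrm{KG}(\mathcal{Q})$ is the graph whose vertices are the vertices of $\mathcal{Q}$, with two distinct vertices adjacent if and only if they lie on no common facet of $\mathcal{Q}$. The facets of $\mathrm{Perm}_n$ are indexed by the subsets $\emptyset\ne I\subsetneq[n]$, the facet of $I$ consisting of the points of $\mathrm{Perm}_n$ with $\sum_{i\in I}x_i=\binom{|I|+1}{2}$; its vertices are the permutations $\sigma$ with $\sigma(I)=\{1,\dots,|I|\}$. A graph on $N$ vertices contains a $k$th power of a Hamiltonian cycle if its vertices can be arranged in a cyclic order $v_1,\dots,v_N$ (each vertex appearing exactly once) such that any two distinct vertices at cyclic distance at most $k$ in this order are adjacent. *)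

(* Defs.v *)
From mathcomp Require Import all_boot all_order all_algebra all_fingroup.
From mathcomp Require Import boolp classical_sets reals convex.

Set Implicit Arguments.
Unset Strict Implicit.
Unset Printing Implicit Defensive.

Import Order.TTheory GRing.Theory Num.Theory.

Local Open Scope classical_set_scope.
Local Open Scope ring_scope.

(** * Simple graphs whose vertices form a set of a given type *)

Record sgraph (T : Type) := SGraph {
  gvert : set T;
  gadj : T -> T -> Prop;
  gadj_vert : forall x y, gadj x y -> gvert x /\ gvert y;
  gadj_sym : forall x y, gadj x y -> gadj y x;
  gadj_irrefl : forall x, ~ gadj x x
}.

Definition cyclic_dist (N i j : nat) : nat :=
  minn ((i + N - j) %% N) ((j + N - i) %% N).

Definition has_ham_cycle_power (T : Type) (k : nat) (G : sgraph T) : Prop :=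
  exists (N : nat) (v : 'I_N -> T),
    [/\ injective v, range v = gvert G &
        forall i j : 'I_N, i != j -> (cyclic_dist N i j <= k)%N ->
          gadj G (v i) (v j)].

(** * Convex geometry in R^n *)

Section Polytopes.
Variables (R : realType) (n : nat).
Implicit Types (A Q F : set 'rV[R]_n) (c x y : 'rV[R]_n).

Definition conv A : set 'rV[R]_n := smallest (@convex_set R 'rV[R]_n) A.

Definition dotp c x : R := \sum_(i < n) c 0 i * x 0 i.

Definition affinely_independent (d : nat) (p : 'I_d.+1 -> 'rV[R]_n) : Prop :=
  row_free (\matrix_(i < d) (p (lift ord0 i) - p ord0)).

(* [A] is nonempty and its affine hull has dimension [d]. *)
Definition has_dim A (d : nat) : Prop :=
  (exists p : 'I_d.+1 -> 'rV[R]_n,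
     (forall i, A (p i)) /\ affinely_independent p) /\
  (forall p : 'I_d.+2 -> 'rV[R]_n,
     (forall i, A (p i)) -> ~ affinely_independent p).

(* The zero functional is allowed, so [Q] and the empty set are faces of [Q]. *)
Definition is_face Q F : Prop :=
  exists (c : 'rV[R]_n) (b : R),
    (forall x, Q x -> dotp c x <= b) /\ F = Q `&` [set x | dotp c x = b].

Definition is_vertex Q x : Prop := is_face Q [set x].

(* The empty face, of dimension -1, is never a facet here.  This differs from
   the usual convention only when [Q] is a point, and the empty face contains
   no vertex. *)
Definition is_facet Q F : Prop :=
  is_face Q F /\ exists d : nat, has_dim Q d.+1 /\ has_dim F d.

Definition kneser_adj Q x y : Prop :=
  [/\ is_vertex Q x, is_vertex Q y, x <> y &
      ~ exists F, [/\ is_facet Q F, F x & F y]].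

Lemma kneser_adj_vert Q x y :
  kneser_adj Q x y -> is_vertex Q x /\ is_vertex Q y.
Proof. by case. Qed.

Lemma kneser_adj_sym Q x y : kneser_adj Q x y -> kneser_adj Q y x.
Proof.
case=> Qx Qy xy nF; split=> //; first by move=> yx; apply: xy.
by case=> F [QF Fy Fx]; apply: nF; exists F.
Qed.

Lemma kneser_adj_irrefl Q x : ~ kneser_adj Q x x.
Proof. by case. Qed.

Definition kneser_graph Q : sgraph 'rV[R]_n :=
  SGraph (@kneser_adj_vert Q) (@kneser_adj_sym Q) (@kneser_adj_irrefl Q).

End Polytopes.

(** * The permutohedron *)

(* ['S_n] permutes [{0, ..., n-1}], hence the shift by one. *)
Definition perm_point (R : realType) (n : nat) (s : 'S_n) : 'rV[R]_n :=
  \row_(i < n) (s i).+1%:R.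

Definition permutohedron (R : realType) (n : nat) : set 'rV[R]_n :=
  conv (range (@perm_point R n)).

Arguments perm_point R {n} s.
Arguments permutohedron R n : clear implicits.

(* Main.v *)
Require Import Defs.
From mathcomp Require Import all_boot all_order all_algebra all_fingroup.
From mathcomp Require Import boolp classical_sets reals convex.
From mathcomp Require Import zify ring lra.
From mathcomp Require Import interval_inference.

Set Implicit Arguments.
Unset Strict Implicit.
Unset Printing Implicit Defensive.

(** The graph on [S_n] is so dense that powers of Hamiltonian cycles can be
    found by a local exchange.

    A face of the permutohedron is the set of maximizers of some linear
    functional [c], and by the rearrangement inequality a vertex [s] maximizes
    [c] only if [s] is sorted like [c].  For a facet, [c] is not constant, so
    the coordinates of small [c]-value form a proper nonempty block that both
    vertices [s] and [t] of the facet send onto the same initial segment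
    [{0, ..., m-1}].  Then [s^-1 * t] stabilizes that segment, that is, it is a
    decomposable permutation ([common_facet_decomposable]).  Together with the
    identification of the vertices ([vertex_permutohedron]) this shows that two
    distinct permutations are adjacent in the Kneser graph as soon as their
    quotient is indecomposable.

    Almost every permutation is indecomposable: the stabilizer of a segment of
    length [m] has [m! (n-m)!] elements, and these numbers add up to at most
    [4 (n-1)!] for [0 < m < n] ([card_decomposable_le]).  Hence every vertex has
    at most [4 n! / n] non-neighbours, while in the [k]th power of a cycle every
    vertex has at most [2 k] neighbours.

    The theorem of Sauer and Spencer ([sauer_spencer]) says that two graphs on
    the same [N] vertices, of maximum degrees [d1] and [d2], can be placed
    edge-disjointly when [2 d1 d2 < N].  It applies to the [k]th power of the
    cycle of length [n!] and to the graph of the pairs with decomposable quotient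
    as soon as [16 k < n].  The latter graph contains all non-edges of the Kneser
    graph, so placing the two edge-disjointly places the power of the cycle
    inside the Kneser graph. *)

(** * Packing two sparse graphs *)

Section SauerSpencer.
Import mathcomp.boot.fintype mathcomp.boot.finset.

Lemma card_bigcup_le (I T : finType) (P : pred I) (F : I -> {set T}) :
  #|\bigcup_(i | P i) F i| <= \sum_(i | P i) #|F i|.
Proof.
apply: (big_ind2 (fun (A : {set T}) a => #|A| <= a)) => //.
  by rewrite cards0.
move=> A a B b Aa Bb; apply: leq_trans (leq_add Aa Bb).
by rewrite -cardsUI leq_addr.
Qed.

Lemma card_comp_rel (T U V : finType) (r : T -> U -> bool) (s : U -> V -> bool)
    (d1 d2 : nat) (x : T) :
  #|[set y | r x y]| <= d1 -> (forall y, #|[set z | s y z]| <= d2) ->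
  #|[set z | [exists y, r x y && s y z]]| <= d1 * d2.
Proof.
move=> rx sy.
have -> : [set z | [exists y, r x y && s y z]] =
    \bigcup_(y in [set y | r x y]) [set z | s y z].
  apply/setP => z; rewrite inE; apply/existsP/bigcupP.
    by case=> y /andP[ry sz]; exists y; rewrite inE.
  by case=> y; rewrite !inE => ry sz; exists y; rewrite ry.
apply: leq_trans (card_bigcup_le _ _) _.
apply: (@leq_trans (\sum_(y in [set y | r x y]) d2)); first exact: leq_sum.
by rewrite sum_nat_const leq_mul2r rx orbT.
Qed.

(** Among all placements, take one with the fewest conflicts.  If an edge [u v]
    is still in conflict, exchanging the images of [u] and of a suitable vertex
    [w] removes this conflict; the vertices [w] for which the exchange creates a
    new one are at distance two from [u] through one edge of each graph, so
    there are at most [2 d1 d2] of them. *)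
Theorem sauer_spencer (T : finType) (e1 e2 : rel T) (d1 d2 : nat) :
  symmetric e1 -> irreflexive e1 -> symmetric e2 ->
  (forall x, #|[set y | e1 x y]| <= d1) ->
  (forall x, #|[set y | e2 x y]| <= d2) ->
  2 * (d1 * d2) < #|T| ->
  exists f : {perm T}, forall x y, e1 x y -> ~~ e2 (f x) (f y).
Proof.
move=> sym1 irr1 sym2 deg1 deg2 small.
pose conflict (f : {perm T}) := [set p | e1 p.1 p.2 && e2 (f p.1) (f p.2)].
pose f := [arg min_(f < (1%g : {perm T})) #|conflict f|].
have fmin g : #|conflict f| <= #|conflict g|.
  by rewrite /f; case: arg_minnP => // h _; apply.
exists f => u v e1uv; apply/negP => e2uv.
(* Swapping the images of [u] and [w] creates a new conflict at [u] only if [w]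
   is in [A], and at [w] only if [w] is in [B]. *)
pose A := [set w | [exists x, e1 u x && e2 (f x) (f w)]].
pose B := [set w | [exists x, e2 (f u) (f x) && e1 x w]].
have degf x : #|[set y | e2 (f x) (f y)]| <= d2.
  rewrite -(card_imset _ (@perm_inj _ f)); apply: leq_trans (deg2 (f x)).
  apply/subset_leq_card/subsetP => _ /imsetP[y + ->]; by rewrite !inE.
have cardA : #|A| <= d1 * d2 by apply: card_comp_rel.
have cardB : #|B| <= d1 * d2.
  by rewrite mulnC; apply: (card_comp_rel (r := fun x y => e2 (f x) (f y))).
(* Besides [A] and [B], [v] is excluded because the swap would leave the edge
   [u v] in conflict; this costs nothing since [u] is counted twice. *)
have [w wAB] : exists w, w \notin A :|: B :|: [set v].
  have uAB : 0 < #|A :&: B|.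
    apply/card_gt0P; exists u; rewrite !inE; apply/andP; split; apply/existsP.
      by exists v; rewrite e1uv sym2.
    by exists v; rewrite sym1 e1uv e2uv.
  have small' : #|A :|: B :|: [set v]| < #|T|.
    have := cardsUI A B; have := cardsUI (A :|: B) [set v].
    rewrite cards1; lia.
  have /card_gt0P[w] : 0 < #|~: (A :|: B :|: [set v])|.
    by rewrite cardsCs setCK subn_gt0.
  by rewrite in_setC; exists w.
have {wAB} [wA wB wv] : [/\ w \notin A, w \notin B & w != v].
  by move: wAB; rewrite !in_setU in_set1 !negb_or => /andP[/andP[]].
have uw : u != w.
  apply: contraNneq wA => <-; rewrite inE; apply/existsP; exists v.
  by rewrite e1uv sym2.
pose g := (tperm u w * f)%g.
have gE x : g x = f (tperm u w x) by rewrite permM.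
have gu y : e1 u y -> e2 (g u) (g y) -> y = w.
  rewrite !gE tpermL => e1uy; case: tpermP => [yu|//|_ _ e2wy].
    by rewrite yu irr1 in e1uy.
  by case/negP: wA; rewrite inE; apply/existsP; exists y; rewrite e1uy sym2.
have gw y : e1 w y -> e2 (g w) (g y) -> y = u.
  rewrite !gE tpermR => e1wy; case: tpermP => [//|yw|_ _ e2uy].
    by rewrite yw irr1 in e1wy.
  by case/negP: wB; rewrite inE; apply/existsP; exists y; rewrite e2uy sym1.
suff : conflict g \proper conflict f.
  by move/proper_card; rewrite ltnNge fmin.
apply/properP; split; last first.
  exists (u, v); first by rewrite inE /= e1uv e2uv.
  apply/negP; rewrite inE /= => /andP[_ /(gu _ e1uv) vw].
  by rewrite vw eqxx in wv.
apply/subsetP => -[x y]; rewrite !inE /= => /andP[e1xy e2xy]; rewrite e1xy /=.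
have fuw : g u = f w /\ g w = f u by rewrite !gE tpermL tpermR.
have [xu|xu] := eqVneq x u.
  move: e1xy e2xy; rewrite xu => e1uy e2uy; have yw := gu _ e1uy e2uy.
  by move: e2uy; rewrite yw fuw.1 fuw.2 sym2.
have [xw|xw] := eqVneq x w.
  move: e1xy e2xy; rewrite xw => e1wy e2wy; have yu := gw _ e1wy e2wy.
  by move: e2wy; rewrite yu fuw.1 fuw.2 sym2.
have [yu|yu] := eqVneq y u.
  move: e1xy e2xy; rewrite yu sym1 sym2 => e1ux e2ux.
  by rewrite (gu _ e1ux e2ux) eqxx in xw.
have [yw|yw] := eqVneq y w.
  move: e1xy e2xy; rewrite yw sym1 sym2 => e1wx e2wx.
  by rewrite (gw _ e1wx e2wx) eqxx in xu.
by move: e2xy; rewrite !gE !tpermD // eq_sym.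
Qed.

End SauerSpencer.

(** * Powers of a cycle *)

Section Cyclic.
Import mathcomp.boot.fintype mathcomp.boot.finset.

Lemma cyclic_distC N i j : cyclic_dist N i j = cyclic_dist N j i.
Proof. by rewrite /cyclic_dist minnC. Qed.

Lemma modn_cyclic N i j : i < N -> j < N ->
  (i + N - j) %% N = if j <= i then i - j else i + N - j.
Proof.
move=> iN jN; case: leqP => ij; last by rewrite modn_small //; lia.
by rewrite -addnBAC // modnDr modn_small //; lia.
Qed.

Lemma card_cyclic_dist_le N k (i : 'I_N) :
  #|[set j : 'I_N | (i != j) && (cyclic_dist N i j <= k)]| <= 2 * k.
Proof.
pose L := [seq (i + r) %% N | r <- iota 1 k] ++
          [seq (i + N - r) %% N | r <- iota 1 k].
rewrite cardE -(size_map val); apply: (@leq_trans (size L)); last first.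
  by rewrite size_cat !size_map size_iota; lia.
apply: uniq_leq_size => [|_ /mapP[j + ->]].
  by rewrite (map_inj_uniq val_inj) enum_uniq.
rewrite mem_enum inE /= => /andP[ij].
have iN := ltn_ord i; have jN := ltn_ord j.
have {}ij : (i : nat) <> j by move=> e; case/eqP: ij; apply: val_inj.
rewrite /cyclic_dist geq_min mem_cat !modn_cyclic //.
rewrite -[\val j]/(j : nat); case/orP=> d; apply/orP; [right|left]; apply/mapP.
  exists ((i + N - j) %% N); rewrite (modn_cyclic iN jN) ?mem_iota.
    by move: d; case: ifP; lia.
  case: leqP => ji; last by rewrite modn_small; lia.
  have -> : i + N - (i - j) = j + N by lia.
  by rewrite modnDr modn_small.
exists ((j + N - i) %% N); rewrite (modn_cyclic jN iN) ?mem_iota.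
  by move: d; case: ifP; lia.
case: leqP => ji; first by rewrite modn_small; lia.
have -> : i + (j + N - i) = j + N by lia.
by rewrite modnDr modn_small.
Qed.

End Cyclic.

(** * Decomposable permutations *)

Section Decomposable.
Import mathcomp.boot.fintype mathcomp.boot.finset.

(** A permutation stabilizing [A] is determined by its restrictions to [A] and to
    the complement of [A]. *)
Lemma card_setstab_le (T : finType) (A : {set T}) :
  #|'N(A | 'P)%g| <= (#|A|)`! * (#|T| - #|A|)`!.
Proof.
have cAC : #|T| - #|A| = #|~: A| by rewrite [RHS]cardsCs setCK.
rewrite cAC -(card_perm A) -(card_perm (~: A)). rewrite -cardX.
pose h (p : {perm T}) := (restr_perm A p, restr_perm (~: A) p).
rewrite -(card_in_imset (f := h)).
  apply/subset_leq_card/subsetP => _ /imsetP[p _ ->].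
  by apply/andP; split; apply: restr_perm_on.
move=> p q pA qA [ep eq]; apply/permP => x.
have NC r : r \in 'N(A | 'P)%g -> r \in 'N(~: A | 'P)%g by rewrite astabsC.
have [xA|xA] := boolP (x \in A).
  by rewrite -(restr_permE pA xA) -(restr_permE qA xA) ep.
have {}xA : x \in ~: A by rewrite inE.
by rewrite -(restr_permE (NC _ pA) xA) -(restr_permE (NC _ qA) xA) eq.
Qed.

Definition initial (n m : nat) : {set 'I_n} := [set i : 'I_n | i < m].

(** Indices start at 0, so the segments of length [0 < m < n] are the proper
    nonempty ones. *)
Definition decomposable (n : nat) (p : 'S_n) : bool :=
  [exists m : 'I_n, (0 < m) && (p \in 'N(initial n m | 'P)%g)].

Lemma decomposableV n (p : 'S_n) : decomposable p^-1%g = decomposable p.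
Proof. by apply: eq_existsb => m; rewrite groupV. Qed.

Lemma card_initial n m : m <= n -> #|initial n m| = m.
Proof.
move=> mn; rewrite -sum1dep_card -(big_ord_widen n (fun=> 1) mn).
by rewrite sum1_card card_ord.
Qed.

(** Two down-closed sets of indices are nested, so they are equal when they have
    the same cardinal. *)
Lemma downclosed_initial n (D : {set 'I_n}) :
  (forall i j : 'I_n, j \in D -> i <= j -> i \in D) -> D = initial n #|D|.
Proof.
move=> Ddown; have Dn : #|D| <= n by rewrite -[leqRHS]card_ord max_card.
have [DI|/subsetPn[a aD aI]] := boolP (D \subset initial n #|D|).
  by apply/eqP; rewrite eqEcard DI card_initial /=.
apply/esym/eqP; rewrite eqEcard card_initial // leqnn andbT.
apply/subsetP => b; rewrite inE => bD; apply: Ddown aD _.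
by move: aI; rewrite inE -leqNgt; apply/leq_trans/ltnW.
Qed.

Lemma image_initial n (I : {set 'I_n}) (s : 'S_n) :
  (forall i j, i \in I -> j \notin I -> s i < s j) -> s @: I = initial n #|I|.
Proof.
move=> sI; rewrite -(card_imset _ (@perm_inj _ s)).
apply: downclosed_initial => a _ /imsetP[i iI ->] ai.
apply/imsetP; exists (s^-1 a)%g; last by rewrite permKV.
by apply: contraLR ai => aI; have := sI _ _ iI aI; rewrite permKV -ltnNge.
Qed.

Lemma same_block_decomposable n (I : {set 'I_n}) (s t : 'S_n) :
  0 < #|I| < n -> s @: I = initial n #|I| -> t @: I = initial n #|I| ->
  decomposable (s^-1 * t)%g.
Proof.
case/andP=> I0 In sI tI; apply/existsP; exists (Ordinal In); rewrite I0 /=.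
rewrite !inE /=; apply/subsetP => a; rewrite -{1}sI => /imsetP[i iI ->].
by rewrite inE /= /aperm permM permK -tI imset_f.
Qed.

(** With [N = a + b + 4], this is ['C(N, 2) <= 'C(N, m)] for [2 <= m <= N - 2]. *)
Lemma fact_mul_le a b : a.+2`! * b.+2`! <= 2 * (a + b).+2`!.
Proof.
elim: a => [|a IH]; first by [].
by rewrite factS -mulnA addSn (factS (a + b).+2) [leqRHS]mulnCA leq_mul //; lia.
Qed.

(** The two extreme terms are [n!], and the others, fewer than [n] in number, are
    at most [2 (n-1)!] each. *)
Lemma sum_fact_le n :
  \sum_(m < n.+1 | 0 < m) m`! * (n.+1 - m)`! <= 4 * n`!.
Proof.
rewrite big_mkcond big_ord_recl /=.
under eq_bigr => i _ do rewrite /bump /= add1n subSS.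
case: n => [|[|n]]; first by rewrite big_ord0.
  by rewrite big_ord_recl big_ord0.
rewrite big_ord_recr big_ord_recl /=.
apply: (@leq_trans (0 + (n.+2`! + \sum_(i < n) 2 * n.+1`! + n.+2`!))).
  rewrite !add0n subn0 mul1n subSnn muln1 leq_add2r leq_add2l.
  apply: leq_sum => i _; rewrite /bump /= add1n.
  have [b nib] : exists b, n = (i + b).+1.
    by exists (n - i.+1); rewrite -addSn subnKC.
  have -> : n.+2 - i.+1 = b.+2 by lia.
  by rewrite {2}nib fact_mul_le.
rewrite sum_nat_const card_ord add0n [n.+2`!]factS; nia.
Qed.

Lemma card_decomposable_le n :
  #|[set p : 'S_n.+1 | decomposable p]| <= 4 * n`!.
Proof.
apply: leq_trans (sum_fact_le n).
have -> : [set p : 'S_n.+1 | decomposable p] =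
    \bigcup_(m < n.+1 | 0 < m) 'N(initial n.+1 m | 'P)%g.
  apply/setP => p; rewrite inE; apply/existsP/bigcupP.
    by case=> m /andP[m0 mp]; exists m.
  by case=> m m0 mp; exists m; rewrite m0.
apply: leq_trans (card_bigcup_le _ _) _; apply: leq_sum => m _.
have := card_setstab_le (initial n.+1 m).
by rewrite card_initial ?card_ord // ltnW.
Qed.

Lemma card_decomposable_quotient_le n (s : 'S_n.+1) :
  #|[set t : 'S_n.+1 | decomposable (s^-1 * t)%g]| <= 4 * n`!.
Proof.
apply: leq_trans (card_decomposable_le n).
rewrite -(card_imset _ (mulgI s^-1%g)).
by apply/subset_leq_card/subsetP => _ /imsetP[t + ->]; rewrite !inE.
Qed.

End Decomposable.

(** * Vertices and facets of the permutohedron *)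

Section Geometry.
Local Open Scope classical_set_scope.
Local Open Scope ring_scope.
Import Order.TTheory GRing.Theory Num.Theory.
Variables (R : realType) (n : nat).
Implicit Types (c x y : 'rV[R]_n) (b : R) (s t : 'S_n).
Local Notation Q := (permutohedron R n).

Lemma dotp_conv c x y (a : {i01 R}) :
  dotp c (convex.conv a (x : convex_lmodType _) y) =
  a%:num * dotp c x + (1 - a%:num) * dotp c y.
Proof.
have -> : convex.conv a (x : convex_lmodType _) y =
  a%:num *: x + (1 - a%:num) *: y by [].
rewrite /dotp !mulr_sumr -big_split /=; apply: eq_bigr => i _.
by rewrite !mxE /=; ring.
Qed.

Lemma permutohedron_sub (P : set 'rV[R]_n) :
  convex_set P -> (forall s, P (perm_point R s)) -> Q `<=` P.
Proof. by move=> cP sP x; apply; split=> // _ [s _ <-]. Qed.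

Lemma perm_point_in s : Q (perm_point R s).
Proof. by move=> P [_]; apply; exists s. Qed.

Lemma permutohedron_dotp_lt c b :
  (forall s, dotp c (perm_point R s) < b) -> forall x, Q x -> dotp c x < b.
Proof.
move=> cb; apply: (permutohedron_sub (P := [set x | dotp c x < b])) => //.
apply/convex_setW => x y; rewrite !inE /= => xb yb a a0 a1.
by rewrite inE /= dotp_conv; nra.
Qed.

Lemma permutohedron_dotp_eq c b :
  (forall s, dotp c (perm_point R s) = b) -> forall x, Q x -> dotp c x = b.
Proof.
move=> cb; apply: (permutohedron_sub (P := [set x | dotp c x = b])) => //.
apply/convex_setW => x y; rewrite !inE /= => xb yb a a0 a1.
by rewrite inE /= dotp_conv xb yb; ring.
Qed.

(** An open half-space stays convex when one point of its boundary is added. *)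
Lemma permutohedron_dotp_uniq c p :
  (forall s, perm_point R s <> p -> dotp c (perm_point R s) < dotp c p) ->
  forall x, Q x -> x <> p -> dotp c x < dotp c p.
Proof.
move=> cb x Qx xp.
suff [//|xb] : [set x | x = p \/ dotp c x < dotp c p] x by [].
apply: permutohedron_sub Qx; last first.
  move=> s; have [sp|sp] := pselect (perm_point R s = p); first by left.
  by right; apply: cb.
apply/convex_setW => {xp}x y; rewrite !inE /= => xb yb a a0 a1; rewrite inE /=.
case: xb => [->|xb]; case: yb => [->|yb]; first by left; rewrite convmm.
all: by right; rewrite dotp_conv; nra.
Qed.

Lemma perm_point_inj : injective (@perm_point R n).
Proof.
move=> s t st; apply/permP => i; apply: val_inj.
move/rowP: st => /(_ i); rewrite !mxE => /eqP.
by rewrite eqr_nat => /eqP[].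
Qed.

(** All points [perm_point R u] have the same norm, so this is the strict case
    of the Cauchy-Schwarz inequality. *)
Lemma dotp_self_perm_point s t : s <> t ->
  dotp (perm_point R s) (perm_point R t) < dotp (perm_point R s) (perm_point R s).
Proof.
move=> st; pose p := perm_point R s; pose q := perm_point R t.
have pp (u : 'S_n) :
    dotp (perm_point R u) (perm_point R u) = \sum_(i < n) (i.+1%:R ^+ 2).
  rewrite /dotp [RHS](reindex_perm u) /=.
  by apply: eq_bigr => i _; rewrite !mxE expr2.
have [i pqi] : exists i, p 0 i != q 0 i.
  apply/existsP; rewrite -negb_forall; apply/negP => /forallP pq.
  by apply: st; apply: perm_point_inj; apply/rowP => i; apply/eqP.
have : 0 < \sum_(i < n) (p 0 i - q 0 i) ^+ 2.
  rewrite (bigD1 i) //= ltr_wpDr //.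
    by apply: sumr_ge0 => j _; apply: sqr_ge0.
  by rewrite lt_def sqr_ge0 sqrf_eq0 subr_eq0 pqi.
have -> : \sum_(i < n) (p 0 i - q 0 i) ^+ 2 =
    dotp p p + dotp q q - 2 * dotp p q.
  rewrite /dotp mulr_sumr -sumrN -!big_split /=; apply: eq_bigr => j _; ring.
by rewrite !pp; lra.
Qed.

(** The point of [s] is exposed by the functional with the same coordinates.
    Conversely, a functional exposing a vertex attains its maximum at some
    [perm_point R s], since otherwise the whole permutohedron would lie in an open
    half-space. *)
Lemma vertex_permutohedron x : is_vertex Q x <-> exists s, x = perm_point R s.
Proof.
split=> [[c [b [cb xF]]]|[s ->]].
  have [Qx cx] : Q x /\ dotp c x = b.
    by have : [set x] x by []; rewrite xF => -[].
  have [[s sb]|nb] := pselect (exists s, dotp c (perm_point R s) = b).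
    exists s; suff : [set x] (perm_point R s) by move=> ->.
    by rewrite xF; split; first exact: perm_point_in.
  suff : dotp c x < b by rewrite cx ltxx.
  apply: permutohedron_dotp_lt Qx => s; rewrite lt_neqAle cb ?andbT.
    by apply/eqP => sb; apply: nb; exists s.
  exact: perm_point_in.
have max := @permutohedron_dotp_uniq (perm_point R s) (perm_point R s).
have {}max y : Q y -> y <> perm_point R s ->
    dotp (perm_point R s) y < dotp (perm_point R s) (perm_point R s).
  apply: max => t ts; apply: dotp_self_perm_point => st.
  by apply: ts; rewrite st.
exists (perm_point R s), (dotp (perm_point R s) (perm_point R s)); split.
  move=> y Qy; have [->//|ys] := pselect (y = perm_point R s).
  by apply: ltW; apply: max.
apply/seteqP; split=> [y ->|y [Qy ys]].
  by split; first exact: perm_point_in.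
by apply: contrapT => /(max _ Qy); rewrite ys ltxx.
Qed.

(** If [c i < c j] but [s j < s i], exchanging the two values increases the
    scalar product by [(c j - c i) (s i - s j)]. *)
Lemma maximizer_sorted c s :
  (forall t, dotp c (perm_point R t) <= dotp c (perm_point R s)) ->
  forall i j, c 0 i < c 0 j -> (s i < s j)%N.
Proof.
move=> smax i j cij; rewrite ltnNge; apply/negP => sji.
have ij : j != i by apply: contraTneq cij => ->; rewrite ltxx.
have {sji} : ((s j).+1%:R : R) < (s i).+1%:R.
  rewrite ltr_nat ltnS ltn_neqAle sji andbT.
  by apply: contra_neq ij => /val_inj/perm_inj.
have := smax (tperm i j * s)%g.
have split2 (x : 'rV[R]_n) : dotp c x =
    c 0 i * x 0 i + (c 0 j * x 0 j +
      \sum_(l | (l != i) && (l != j)) c 0 l * x 0 l).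
  by rewrite /dotp (bigD1 i) //= (bigD1 j ij).
rewrite !split2 (eq_bigr (fun l => c 0 l * perm_point R s 0 l)); last first.
  by move=> l /andP[li lj]; rewrite !mxE permM tpermD // eq_sym.
by rewrite !mxE !permM tpermL tpermR; nra.
Qed.

(** A constant functional takes the same value at all [perm_point R t], hence on
    the whole permutohedron, so that it would define a face of full dimension. *)
Lemma facet_functional_nonconstant F c b s :
  (exists d, has_dim Q d.+1 /\ has_dim F d) ->
  F = Q `&` [set x | dotp c x = b] -> F (perm_point R s) ->
  exists i j, c 0 i < c 0 j.
Proof.
move=> [d [[[p [Qp pind]] _] [_ Fd]]] FE Fs; apply: contrapT => ncst.
have cst i j : c 0 i = c 0 j.
  by apply/eqP; rewrite eq_le !leNgt; apply/andP; split; apply/negP => cij;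
     apply: ncst; do 2 eexists; exact: cij.
have [_ sb] : Q (perm_point R s) /\ dotp c (perm_point R s) = b.
  by move: Fs; rewrite FE.
apply: (Fd p) => // i; rewrite FE; split=> //=.
apply: permutohedron_dotp_eq (Qp i) => t; rewrite -sb /dotp.
rewrite [RHS](reindex_perm (t * s^-1)%g) /=; apply: eq_bigr => l _.
by rewrite !mxE permM permKV (cst l (s^-1 (t l))%g).
Qed.

(** Both [s] and [t] send the block of the coordinates with small [c]-value, [c]
    being the functional of the facet, onto the same initial segment. *)
Lemma common_facet_decomposable F s t :
  is_facet Q F -> F (perm_point R s) -> F (perm_point R t) ->
  decomposable (s^-1 * t)%g.
Proof.
move=> [[c [b [cb FE]]] dimF] Fs Ft.
have [i0 [j0 cij]] := facet_functional_nonconstant dimF FE Fs.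
pose I := [set i | c 0 i <= c 0 i0]%SET.
have image u : F (perm_point R u) -> (u @: I)%SET = initial n #|I|.
  rewrite FE => -[_ /= ub]; apply: image_initial => i j.
  rewrite !inE -ltNge => ci cj; apply: (maximizer_sorted (c := c)).
    by move=> u'; rewrite ub; apply: cb; apply: perm_point_in.
  exact: le_lt_trans ci cj.
apply: (same_block_decomposable _ (image _ Fs) (image _ Ft)).
apply/andP; split; first by apply/card_gt0P; exists i0; rewrite inE.
rewrite -[ltnRHS]card_ord -cardsT proper_card // properT.
apply: contraL cij => /eqP IT; rewrite -leNgt.
by have : j0 \in I; [rewrite IT finset.in_setT|rewrite inE].
Qed.

Lemma kneser_adj_indecomposable s t :
  s <> t -> ~~ decomposable (s^-1 * t)%g ->
  kneser_adj Q (perm_point R s) (perm_point R t).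
Proof.
move=> st /negP indec; split.
- by apply/vertex_permutohedron; exists s.
- by apply/vertex_permutohedron; exists t.
- by move/perm_point_inj.
by case=> F [facetF Fs Ft]; apply: indec; apply: common_facet_decomposable Ft.
Qed.

End Geometry.

(** * Powers of Hamiltonian cycles *)

Theorem theorem1p3 (R : realType) (k : nat) (hk : (1 <= k)%N) :
  exists n0 : nat, forall n : nat, (n0 <= n)%N ->
    has_ham_cycle_power k (kneser_graph (permutohedron R n)).
Proof.
exists (16 * k).+1 => -[//|n] kn.
pose N := #|{: 'S_n.+1}|.
pose near (i j : 'I_N) := (i != j) && (cyclic_dist N i j <= k).
pose share_facet (i j : 'I_N) :=
  decomposable ((enum_val i : 'S_n.+1)^-1 * enum_val j)%g.
have [f disjoint] : exists f : {perm 'I_N},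
    forall i j, near i j -> ~~ share_facet (f i) (f j).
  apply: (sauer_spencer (d1 := 2 * k) (d2 := 4 * n`!)).
  - by move=> i j; rewrite /near eq_sym cyclic_distC.
  - by move=> i; rewrite /near eqxx.
  - by move=> i j; rewrite /share_facet -decomposableV invMg invgK.
  - by move=> i; apply: card_cyclic_dist_le.
  - move=> i; rewrite -(card_imset _ (@enum_val_inj _ {: 'S_n.+1})).
    apply: leq_trans (card_decomposable_quotient_le (enum_val i)).
    apply/subset_leq_card/fintype.subsetP => _ /imsetP[j + ->].
    by rewrite !inE.
  have -> : #|'I_N| = n.+1`! by rewrite card_ord /N card_Sn.
  by rewrite factS; have := fact_gt0 n; nia.
exists N, (fun i => perm_point R (enum_val (f i))); split.
- by move=> i j /perm_point_inj /enum_val_inj /perm_inj.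
- apply/seteqP; split=> [_ [i _ <-]|x /= /vertex_permutohedron[s ->]].
    by apply/vertex_permutohedron; eexists.
  by exists (f^-1 (enum_rank s))%g => //; rewrite permKV enum_rankK.
move=> i j ij dij; apply: kneser_adj_indecomposable.
  by move/enum_val_inj/perm_inj/eqP; rewrite (negbTE ij).
by apply: disjoint; rewrite /near ij.
Qed.
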